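(* Assume that every $\omega^2$-decidable proposition is semidecidable. Then Markov's principle implies $\mathsf{LPO}$.
   Context: We work in homotopy type theory with propositional truncation. A proposition $Q$ is semidecidable if $\exists (s:\mathbb N\to\mathbf 2).\,(Q\leftrightarrow\exists i.\,s_i=1)$. Markov's principle: for every $s:\mathbb N\to\mathbf 2$, if $\neg(\forall i.\,s_i=0)$ then $\exists i.\,s_i=1$. $\mathsf{LPO}$: for every $s:\mathbb N\to\mathbf 2$, either $\exists i.\,s_i=1$ or $\forall i.\,s_i=0$. $\mathsf{Brw}$ is the type of Brouwer ordinals, defined as a set-truncated quotient inductive-inductive type simultaneously with a proposition-valued relation $\le$: point constructors $\mathsf{zero}$, $\mathsf{succ}$, and $\mathsf{lim}$ of strictly increasing sequences $f:\mathbb N\to\mathsf{Brw}$ ($\forall n.\,\mathsf{succ}(f_n)\le f_{n+1}$); a path constructor identifying limits of mutually simulating sequences; $\le$ is transitive, proposition-valued, with $\mathsf{zero}$ minimal, $\mathsf{succ}$ monotone, $\mathsf{lim}\,f$ the least upper bound of $f$. $\omega=\mathsf{lim}(\lambda n.\,n)$, $\omega^2=\mathsf{lim}(\lambda k.\,\omega\cdot k)$. A proposition $P$ is $\alpha$-decidable if $\exists y:\mathsf{Brw}.\,(P\leftrightarrow \alpha\le y)$. *)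

(* Defs.v *)
Set Implicit Arguments.
Unset Strict Implicit.

Definition is_prop (A : Type) : Prop := forall x y : A, x = y.
Definition is_set (A : Type) : Prop := forall (x y : A) (p q : x = y), p = q.

Section Sequences.

Variables (B : Type) (le : B -> B -> Prop) (succ : B -> B).

Definition increasing (f : nat -> B) : Prop := forall n, le (succ (f n)) (f (S n)).

Definition simulated (f g : nat -> B) : Prop := forall k, exists n, le (f k) (g n).

End Sequences.

(* Rocq has no quotient inductive-inductive types, so [Brw] is given by its
   universal property: a [Brouwer] structure consists of the constructors of the
   point type and of the relation, together with the dependent elimination
   principle (and its computation rules) that these constructors generate. Such
   a structure is unique up to unique isomorphism. *)
Record Brouwer : Type := {
  Brw :> Type;
  le : Brw -> Brw -> Prop;
  zero : Brw;
  succ : Brw -> Brw;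
  lim : forall f : nat -> Brw, increasing le succ f -> Brw;
  bisim : forall (f g : nat -> Brw)
      (p : increasing le succ f) (q : increasing le succ g),
    simulated le f g -> simulated le g f -> lim p = lim q;
  Brw_set : is_set Brw;

  le_zero : forall x, le zero x;
  le_trans : forall x y z, le x y -> le y z -> le x z;
  le_succ : forall x y, le x y -> le (succ x) (succ y);
  le_cocone : forall x f (p : increasing le succ f) k, le x (f k) -> le x (lim p);
  le_limiting : forall f (p : increasing le succ f) x,
    (forall k, le (f k) x) -> le (lim p) x;
  le_prop : forall x y, is_prop (le x y);

  (* [P] and [Q] are the motives for [Brw] and [le]; the methods are the
     constructors above, displayed over [P] and [Q]. *)
  Brw_elim :
    forall (P : Brw -> Type)
      (Q : forall x y, le x y -> P x -> P y -> Prop)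
      (P_set : forall x, is_set (P x))
      (Q_prop : forall x y (l : le x y) u v, is_prop (Q x y l u v))
      (z : P zero)
      (s : forall x, P x -> P (succ x))
      (m : forall f (p : increasing le succ f) (F : forall n, P (f n)),
        (forall n, Q (succ (f n)) (f (S n)) (p n) (s (f n) (F n)) (F (S n))) ->
        P (lim p))
      (P_bisim : forall f g (p : increasing le succ f) (q : increasing le succ g)
          (fg : simulated le f g) (gf : simulated le g f)
          (F : forall n, P (f n)) (G : forall n, P (g n)) hF hG,
        (forall k, exists n, exists l : le (f k) (g n), Q (f k) (g n) l (F k) (G n)) ->
        (forall k, exists n, exists l : le (g k) (f n), Q (g k) (f n) l (G k) (F n)) ->
        eq_rect (lim p) P (m f p F hF) (lim q) (bisim p q fg gf) = m g q G hG)
      (Q_zero : forall x (u : P x), Q zero x (le_zero x) z u)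
      (Q_trans : forall x y w (l : le x y) (l' : le y w) u v t,
        Q x y l u v -> Q y w l' v t -> Q x w (le_trans l l') u t)
      (Q_succ : forall x y (l : le x y) u v,
        Q x y l u v -> Q (succ x) (succ y) (le_succ l) (s x u) (s y v))
      (Q_cocone : forall x f (p : increasing le succ f) k (l : le x (f k)) u F hF,
        Q x (f k) l u (F k) -> Q x (lim p) (le_cocone p l) u (m f p F hF))
      (Q_limiting : forall f (p : increasing le succ f) x
          (l : forall k, le (f k) x) F hF u,
        (forall k, Q (f k) x (l k) (F k) u) ->
        Q (lim p) x (le_limiting p l) (m f p F hF) u),
    { h : forall x, P x |
        (forall x y (l : le x y), Q x y l (h x) (h y)) /\
        h zero = z /\
        (forall x, h (succ x) = s x (h x)) /\
        (forall f (p : increasing le succ f) hF,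
          h (lim p) = m f p (fun n => h (f n)) hF) }
}.

Arguments le {b} x y.
Arguments zero {b}.
Arguments succ {b} x.
Arguments lim {b} f p.
Arguments le_cocone {b x} f p k _.
Arguments le_limiting {b} f p {x} _.

Lemma is_prop_is_set (A : Type) : is_prop A -> is_set A.
Proof.
intros H x y p q.
assert (E : forall r : x = y, r = eq_trans (eq_sym (H x x)) (H x y)).
{ intros []; destruct (H x x); reflexivity. }
rewrite (E p), (E q); reflexivity.
Qed.

Section Ordinals.

Variable B : Brouwer.

Lemma le_refl (x : B) : le x x.
Proof.
assert (T : is_prop True) by (intros [] []; reflexivity).
assert (L : forall (f : nat -> B) (p : increasing le succ f), (forall n, le (f n) (f n)) ->
  le (lim f p) (lim f p)).
{ intros f p F; apply le_limiting; intros k; apply (le_cocone f p k), F. }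
refine (proj1_sig (@Brw_elim B (fun x => le x x) (fun _ _ _ _ _ => True)
  _ (fun _ _ _ _ _ => T) _ _ (fun f p F _ => L f p F) _ _ _ _ _ _) x); auto.
- intros y; apply is_prop_is_set, le_prop.
- apply le_zero.
- intros y; apply le_succ.
- intros; apply le_prop.
Qed.

(* [add_nat x n] is x + n. *)
Fixpoint add_nat (x : B) (n : nat) : B :=
  match n with
  | 0 => x
  | S n => succ (add_nat x n)
  end.

Lemma add_nat_increasing (x : B) : increasing le succ (add_nat x).
Proof. intros n; apply le_refl. Qed.

Definition of_nat (n : nat) : B := add_nat zero n.

Definition omega : B := lim of_nat (add_nat_increasing zero).

(* x + omega, following the recursion x + lim f = lim (fun n => x + f n). *)
Definition add_omega (x : B) : B := lim (add_nat x) (add_nat_increasing x).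

(* omega * k for a natural number k, following the recursion
   omega * 0 = 0 and omega * succ k = omega * k + omega. *)
Fixpoint omega_mul (k : nat) : B :=
  match k with
  | 0 => zero
  | S k => add_omega (omega_mul k)
  end.

Lemma omega_mul_1 : omega_mul 1 = omega.
Proof. reflexivity. Qed.

Lemma omega_mul_increasing : increasing le succ omega_mul.
Proof.
intros k; apply (le_cocone (add_nat (omega_mul k)) _ 1), le_refl.
Qed.

Definition omega_squared : B := lim omega_mul omega_mul_increasing.

Definition ordinal_decidable (alpha : B) (P : Prop) : Prop :=
  exists y : B, P <-> le alpha y.

End Ordinals.

Definition semidecidable (Q : Prop) : Prop :=
  exists s : nat -> bool, Q <-> exists i, s i = true.

Definition Markov_principle : Prop :=
  forall s : nat -> bool, ~ (forall i, s i = false) -> exists i, s i = true.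

Definition LPO : Prop :=
  forall s : nat -> bool, (exists i, s i = true) \/ (forall i, s i = false).

(* Main.v *)
(** For a binary sequence [s], let [y] be the supremum of the sequence that adds
    [omega] at each step until the first [true] of [s], and adds [1] at each step
    from then on. If [s] is constantly [false] then [y = omega^2]; if [s i = true]
    then [y <= omega * (i + 1)], which is not above [omega^2]. Hence
    "[s] is constantly [false]" is [omega^2]-decidable, so it is semidecidable by
    assumption. Its negation is semidecidable too, and Markov's principle finds a
    witness for one of the two.

    That [omega^2] does not lie below [omega * (i + 1)] is seen by mapping each
    ordinal [x] to the set of pairs [(a, b)] with [omega * a + b < x]. Only the
    univalence principles for propositions (propositional and function
    extensionality) are used; no classical axiom is, under which [LPO] would hold
    trivially. *)

From Stdlib Require Import Lia FunctionalExtensionality PropExtensionality.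
Require Import Defs.

Definition lex_lt (a' b' a b : nat) : Prop := a' < a \/ a' = a /\ b' < b.

Section LexRank.

Variable B : Brouwer.

(** Elimination into predicates ordered by inclusion; mutually simulating sequences have equal
    unions. The successor clause encodes [omega * a + b <= x] by asking that all smaller pairs lie
    below [x], which is visibly monotone in [x]. *)
Lemma exists_lex_rank :
  exists h : B -> nat -> nat -> Prop,
    (forall x y, le x y -> forall a b, h x a b -> h y a b) /\
    (forall a b, ~ h zero a b) /\
    (forall x a b,
      h (succ x) a b <-> forall a' b', lex_lt a' b' a b -> h x a' b') /\
    (forall f p a b, h (lim f p) a b <-> exists n, h (f n) a b).
Proof.
destruct (@Brw_elim B (fun _ => nat -> nat -> Prop)
  (fun _ _ _ X Y => forall a b, X a b -> Y a b)) with
  (z := fun _ _ : nat => False)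
  (s := fun (_ : B) (X : nat -> nat -> Prop) a b =>
    forall a' b', lex_lt a' b' a b -> X a' b')
  (m := fun (f : nat -> B) (_ : increasing le succ f)
    (F : nat -> nat -> nat -> Prop)
    (_ : forall n a b,
      (forall a' b', lex_lt a' b' a b -> F n a' b') -> F (S n) a b) a b =>
    exists n, F n a b)
  as [h (hle & hz & hs & hl)].
- intros _ X Y p q; apply proof_irrelevance.
- intros x y l u v p q; apply proof_irrelevance.
- intros f g p q fg gf F G hF hG FG GF.
  destruct (bisim p q fg gf); simpl.
  apply functional_extensionality; intros a.
  apply functional_extensionality; intros b.
  apply propositional_extensionality; split; intros [k H].
  + destruct (FG k) as (n & _ & K); exists n; auto.
  + destruct (GF k) as (n & _ & K); exists n; auto.
- intros x u a b [].
- auto.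
- auto.
- intros x f p k l u F hF H a b K; exists k; auto.
- intros f p x l F hF u H a b [n K]; eauto.
- exists h; split; [exact hle | split; [| split]].
  + intros a b; rewrite hz; auto.
  + intros x a b; rewrite hs; reflexivity.
  + intros f p a b.
    (* The rule at [lim] needs the ranks along [f] to increase: this is [hle] at [p n], transported
       along [hs]. *)
    rewrite (hl f p (fun n a b H =>
      hle _ _ (p n) a b (eq_ind_r (fun X => X a b) H (hs (f n))))).
    reflexivity.
Qed.

Lemma le_succ_add_omega (x : B) : le (succ x) (add_omega x).
Proof. apply (le_cocone (add_nat x) _ 1), le_refl. Qed.

Section Bounds.

Variable h : B -> nat -> nat -> Prop.
Hypothesis h_zero : forall a b, ~ h zero a b.
Hypothesis h_succ : forall x a b,
  h (succ x) a b <-> forall a' b', lex_lt a' b' a b -> h x a' b'.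
Hypothesis h_lim : forall f p a b, h (lim f p) a b <-> exists n, h (f n) a b.

Lemma lex_rank_add_nat (x : B) (k : nat) :
  (forall a b, h x a b <-> a < k) ->
  forall n a b, h (add_nat x n) a b <-> lex_lt a b k n.
Proof.
unfold lex_lt; intros hx n; induction n as [|n IH]; intros a b; simpl.
- rewrite hx; lia.
- rewrite h_succ; split.
  + intros H.
    (* Otherwise [(k, n)] itself would lie below [add_nat x n], hence below itself; the
       lexicographic order on pairs is decidable and total. *)
    assert (~ lex_lt k n a b).
    { intros K; apply H, IH in K; lia. }
    unfold lex_lt in *; lia.
  + intros H a' b' K; apply IH; unfold lex_lt in *; lia.
Qed.

Lemma lex_rank_add_omega (x : B) (k : nat) :
  (forall a b, h x a b <-> a < k) ->
  forall a b, h (add_omega x) a b <-> a < S k.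
Proof.
intros hx a b; unfold add_omega; rewrite h_lim; split.
- intros [n H]; apply (lex_rank_add_nat x k hx) in H; unfold lex_lt in H; lia.
- intros H; exists (S b); apply (lex_rank_add_nat x k hx); unfold lex_lt; lia.
Qed.

Lemma lex_rank_omega_mul (k : nat) :
  forall a b, h (omega_mul B k) a b <-> a < k.
Proof.
induction k as [|k IH]; simpl.
- intros a b; split; [intros H; destruct (h_zero _ _ H) | lia].
- apply lex_rank_add_omega, IH.
Qed.

Lemma lex_rank_omega_squared (a b : nat) : h (omega_squared B) a b.
Proof. apply h_lim; exists (S a); apply lex_rank_omega_mul; lia. Qed.

End Bounds.

End LexRank.

Section Jump.

Variable B : Brouwer.

(** The accumulator [x] is the ordinal reached so far, and [n] counts the steps left, including the
    current one. *)
Fixpoint jump (s : nat -> bool) (x : B) (n : nat) : B :=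
  match n with
  | 0 => x
  | S m => if s 0 then add_nat x n else jump (fun i => s (S i)) (add_omega x) m
  end.

Lemma jump_increasing (s : nat -> bool) (x : B) : increasing le succ (jump s x).
Proof.
intros n; revert s x; induction n as [|n IH]; intros s x.
- simpl; destruct (s 0); [apply le_refl | apply le_succ_add_omega].
- change (le (succ (jump s x (S n)))
    (if s 0 then add_nat x (S (S n))
     else jump (fun i => s (S i)) (add_omega x) (S n))).
  simpl (jump s x (S n)); destruct (s 0); [apply le_refl | apply IH].
Qed.

Lemma jump_false (s : nat -> bool) (k n : nat) :
  (forall i, s i = false) -> jump s (omega_mul B k) n = omega_mul B (n + k).
Proof.
revert s k; induction n as [|n IH]; intros s k hs; simpl; [reflexivity|].
rewrite hs; change (add_omega (omega_mul B k)) with (omega_mul B (S k)).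
rewrite IH by auto.
replace (n + S k) with (S (n + k)) by lia; reflexivity.
Qed.

(** Each [false] before index [i] raises [k] by one, and finite successors never do. The bound is
    independent of [n], so it survives the limit. *)
Lemma lex_rank_jump_true (h : B -> nat -> nat -> Prop)
    (h_succ : forall x a b,
      h (succ x) a b <-> forall a' b', lex_lt a' b' a b -> h x a' b')
    (h_lim : forall f p a b, h (lim f p) a b <-> exists n, h (f n) a b)
    (s : nat -> bool) (i : nat) (x : B) (k n : nat) :
  s i = true -> (forall a b, h x a b <-> a < k) ->
  forall a b, h (jump s x n) a b -> a <= i + k.
Proof.
revert s i x k; induction n as [|n IH]; intros s i x k hs hx a b H.
- apply hx in H; lia.
- cbn [jump] in H; destruct (s 0) eqn:s0.
  + apply (lex_rank_add_nat B h h_succ x k hx) in H; unfold lex_lt in H; lia.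
  + destruct i as [|i]; [congruence|].
    apply (IH _ i _ (S k) hs (lex_rank_add_omega B h h_succ h_lim x k hx)) in H; lia.
Qed.

Lemma ordinal_decidable_forall_false (s : nat -> bool) :
  ordinal_decidable (omega_squared B) (forall i, s i = false).
Proof.
exists (lim (jump s zero) (jump_increasing s zero)); split.
- intros hs; apply le_limiting; intros k.
  apply (le_cocone (jump s zero) _ k).
  change (@zero B) with (omega_mul B 0).
  rewrite (jump_false s 0 k hs).
  replace (k + 0) with k by lia; apply le_refl.
- intros H i; destruct (s i) eqn:si; [exfalso | reflexivity].
  destruct (exists_lex_rank B) as (h & h_le & h_zero & h_succ & h_lim).
  (* The pair [(S i, 0)] is below [omega_squared], but just exceeds the bound [i + 0] on first
     components. *)
  pose proof (h_le _ _ H _ _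
    (lex_rank_omega_squared B h h_zero h_succ h_lim (S i) 0)) as K.
  apply h_lim in K; destruct K as [n K].
  apply (lex_rank_jump_true h h_succ h_lim s i zero 0 n si
    (lex_rank_omega_mul B h h_zero h_succ h_lim 0)) in K; lia.
Qed.

End Jump.

Lemma Markov_decides (s : nat -> bool) :
  Markov_principle -> semidecidable (forall i, s i = false) ->
  (exists i, s i = true) \/ (forall i, s i = false).
Proof.
intros MP [t ht].
(* The disjunction cannot be constantly [false]: if [s] is, then [t] takes the value [true]. *)
destruct (MP (fun i => orb (s i) (t i))) as [i hi].
- intros H.
  assert (hs : forall i, s i = false).
  { intros i; apply (Bool.orb_false_elim _ _ (H i)). }
  destruct (proj1 ht hs) as [i hi].
  destruct (Bool.orb_false_elim _ _ (H i)); congruence.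
- apply Bool.orb_true_elim in hi; destruct hi as [hi | hi].
  + left; exists i; exact hi.
  + right; apply ht; exists i; exact hi.
Qed.

Theorem theorem8p4 (B : Brouwer) :
  (forall P : Prop, ordinal_decidable (omega_squared B) P -> semidecidable P) ->
  Markov_principle -> LPO.
Proof.
intros H MP s.
apply (Markov_decides s MP), H, ordinal_decidable_forall_false.
Qed.
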